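(* Let $\alpha\ge0$. Assume that for all $z,z'\in\mathcal Z$ the function $f(\cdot;z,z')$ is $G$-Lipschitz on $\mathcal W$ (i.e. $|f(\mathbf w;z,z')-f(\mathbf w';z,z')|\le G\|\mathbf w-\mathbf w'\|_2$) and $\alpha$-strongly convex (i.e. $f(\mathbf w;z,z')-f(\mathbf w';z,z')-\langle\nabla f(\mathbf w';z,z'),\mathbf w-\mathbf w'\rangle\ge\frac\alpha2\|\mathbf w-\mathbf w'\|_2^2$; $\alpha=0$ means convex), and that $\sup_{\mathbf w\in\mathcal W}f(\mathbf w;z,z')\le B$ for all $z,z'\in\mathcal Z$, for some $B>0$. Let $\mathbf w_{-1}=\mathbf w_0$ and let $\{\mathbf w_j:j\in[t]\}$ be produced by the SGD algorithm for pairwise learning (see context) on a fixed dataset $S$. Let $\delta\in(0,1)$. (a) If $\alpha=0$ and $\bar{\mathbf w}_t=\sum_{j=1}^t\eta_j\mathbf w_{j-2}/\sum_{j=1}^t\eta_j$, then for any $\mathbf w\in\mathcal W$, with probability at least $1-\delta$, $$F_S(\bar{\mathbf w}_t)-F_S(\mathbf w)\le\frac1{\sum_{j=1}^t\eta_j}\Big(2B\Big(2\sum_{j=1}^t\eta_j^2\log(2/\delta)\Big)^{1/2}+\frac12\|\mathbf w_0-\mathbf w\|_2^2+G^2\sum_{j=1}^t\big(\eta_{j-1}\eta_j+\tfrac{\eta_j^2}2\big)\Big).$$ (b) If $\alpha>0$, $\eta_j=\frac2{\alpha(j+1)}$ and $\bar{\mathbf w}_t=\sum_{j=1}^tj\,\mathbf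 w_{j-2}/\sum_{j=1}^tj$, then for any $\mathbf w\in\mathcal W$, with probability at least $1-\delta$, $F_S(\bar{\mathbf w}_t)-F_S(\mathbf w)=\mathcal O\big(G^2\log(1/\delta)/(\alpha t)\big)$, where the $\mathcal O$ is understood for $t\ge1$ and $\delta$ bounded away from $1$ (e.g. $\delta\le1/2$), with implied constant independent of $t$, $\delta$, $n$ and $S$.
   Context: Setting: $\mathcal W\subseteq\mathbb R^d$ is a nonempty closed convex parameter set with Euclidean projection $\Pi_{\mathcal W}$; $f:\mathcal W\times\mathcal Z\times\mathcal Z\to[0,\infty)$ is a pairwise loss; $\nabla f(\mathbf w;z,z')$ is the gradient (a subgradient if $f$ is nondifferentiable) in $\mathbf w$. $S=\{z_1,\dots,z_n\}\subset\mathcal Z$ ($n\ge2$) is the training dataset; $[n]=\{1,\dots,n\}$. Empirical risk: $F_S(\mathbf w)=\frac1{n(n-1)}\sum_{i,j\in[n],i\ne j}f(\mathbf w;z_i,z_j)$. SGD algorithm for pairwise learning: given $S$, positive step sizes $\{\eta_t\}$ and $\mathbf w_0\in\mathcal W$, draw $i_0,i_1,i_2,\dots$ independently and uniformly from $[n]$; for $t=1,2,\dots$ set $\mathbf w_t=\Pi_{\mathcal W}\big(\mathbf w_{t-1}-\eta_t\nabla f(\mathbf w_{t-1};z_{i_t},z_{i_{t-1}})\big)$. The number $\eta_0$ occurring in sums is any nonnegative number (no step with $\eta_0$ is performed). Probability is over the indices $\{i_t\}$.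
   Formalization: Both bounds gain the term b(w̄_t)−b(w), b = F_S minus the mean of f over all n² pairs (i_t may equal i_{t-1}; false as stated otherwise); a subgradient that is not a gradient at a boundary point of W is required to have norm at most G. *)

(* Defs.v *)
(* MathComp / MathComp-Analysis *)
From HB Require Import structures.
From mathcomp Require Import all_boot all_order all_algebra.
From mathcomp Require Import all_classical all_reals all_analysis.

Set Implicit Arguments.
Unset Strict Implicit.
Unset Printing Implicit Defensive.

Import Order.TTheory GRing.Theory Num.Theory.
Import numFieldNormedType.Exports.

Local Open Scope classical_set_scope.
Local Open Scope ring_scope.

(* The library norm on row vectors is the sup norm; it induces the same
   topology as l2norm, so closed, interior and nbhs have their usual meaning. *)
Definition dotp (R : realType) (d : nat) (u v : 'rV[R]_d) : R :=
  \sum_(k < d) u 0 k * v 0 k.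

Definition l2norm (R : realType) (d : nat) (u : 'rV[R]_d) : R :=
  Num.sqrt (dotp u u).

Definition proj (R : realType) (d : nat) (W : set 'rV[R]_d) (x : 'rV[R]_d) :
    'rV[R]_d :=
  xget 0 [set p | W p /\ forall u, W u -> l2norm (x - p) <= l2norm (x - u)].

(* A loss is only meaningful on W, so differentiability is relative to W. *)
Definition is_gradient (R : realType) (d : nat) (W : set 'rV[R]_d)
    (h : 'rV[R]_d -> R) (w g : 'rV[R]_d) : Prop :=
  forall e : R, 0 < e -> \forall u \near nbhs w, W u ->
    `|h u - h w - dotp g (u - w)| <= e * l2norm (u - w).

Definition is_subgradient (R : realType) (d : nat) (W : set 'rV[R]_d)
    (h : 'rV[R]_d -> R) (w g : 'rV[R]_d) : Prop :=
  forall u, W u -> h w + dotp g (u - w) <= h u.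

(* A subgradient of a G-Lipschitz function has norm at most G at every interior
   point of W.  At a boundary point, the subgradients of the restriction to W
   form an unbounded set (they absorb the normal cone), and SGD run with
   arbitrary ones need not converge; there the bound is part of the
   convention.  Nothing is asked of a true gradient. *)
Definition loss_gradient (R : realType) (d : nat) (W : set 'rV[R]_d) (G : R)
    (h : 'rV[R]_d -> R) (w g : 'rV[R]_d) : Prop :=
  is_gradient W h w g \/
  is_subgradient W h w g /\ (interior W w \/ l2norm g <= G).

Section Algorithm.
Variables (R : realType) (d : nat) (Z : Type).
Variables (f : 'rV[R]_d -> Z -> Z -> R) (gradf : 'rV[R]_d -> Z -> Z -> 'rV[R]_d).
Variables (n : nat) (z : 'I_n -> Z).

Definition emp_risk (w : 'rV[R]_d) : R :=
  (n%:R * (n%:R - 1))^-1 * \sum_(i < n) \sum_(j < n | j != i) f w (z i) (z j).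

(* The mean of f(w; z_i, z_i') over independent uniform i, i': two consecutive
   draws coincide with probability 1/n, so this includes the diagonal, unlike
   emp_risk.  SGD on iid indices decreases draw_risk; the excess emp_risk is
   controlled only up to the increment of the difference, sampling_bias. *)
Definition draw_risk (w : 'rV[R]_d) : R :=
  (n%:R ^+ 2)^-1 * \sum_(i < n) \sum_(j < n) f w (z i) (z j).

Definition sampling_bias (w : 'rV[R]_d) : R := emp_risk w - draw_risk w.

Fixpoint sgd (W : set 'rV[R]_d) (eta : nat -> R) (w0 : 'rV[R]_d)
    (idx : nat -> 'I_n) (t : nat) : 'rV[R]_d :=
  if t is s.+1 then
    let w := sgd W eta w0 idx s in
    proj W (w - eta s.+1 *: gradf w (z (idx s.+1)) (z (idx s)))
  else w0.

(* \sum_(j = 1)^t a_j w_{j-2} / \sum_(j = 1)^t a_j; for j = 1 the truncated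
   subtraction gives w_0, which is the convention w_{-1} = w_0. *)
Definition sgd_average (a : nat -> R) (W : set 'rV[R]_d) (eta : nat -> R)
    (w0 : 'rV[R]_d) (idx : nat -> 'I_n) (t : nat) : 'rV[R]_d :=
  (\sum_(1 <= j < t.+1) a j)^-1 *:
    \sum_(1 <= j < t.+1) a j *: sgd W eta w0 idx (j - 2)%N.

End Algorithm.

Definition iid_uniform (R : realType) (dsp : measure_display)
    (Om : measurableType dsp) (P : probability Om R) (n : nat)
    (I : nat -> Om -> 'I_n) : Prop :=
  [/\ forall k i, measurable (I k @^-1` [set i]),
      forall k i, P (I k @^-1` [set i]) = (n%:R^-1)%:E
    & forall (s : seq nat) (a : nat -> 'I_n), uniq s ->
        P (\bigcap_(k in [set` s]) (I k @^-1` [set a k])) =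
        (\prod_(k <- s) P (I k @^-1` [set a k]))%E].

(* Main.v *)
(** One SGD step moves the iterate closer to a comparison point u up to the loss
of the drawn pair, so the weighted sum of the excess losses of the drawn pairs
telescopes.  These losses differ from the excess draw_risk by a noise.  The
iterate with index j - 2 is independent of the two indices drawn for step j, so
Hoeffding's lemma bounds the exponential moment of the noise given the past two
steps back; noise terms with indices of equal parity thus form a supermartingale,
and the two parities are recombined by the inequality of the arithmetic and
geometric means.  In the strongly convex case the range of the noise is of order
G times the distance to u; if u nearly minimises draw_risk, quadratic growth
bounds the variance term by half of the excess risk. *)
Require Import Defs.
From HB Require Import structures.
From mathcomp Require Import all_boot all_order all_algebra.
From mathcomp Require Import all_classical all_reals all_analysis.
From mathcomp Require Import zify ring lra.

Set Implicit Arguments.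
Unset Strict Implicit.
Unset Printing Implicit Defensive.

Import Order.TTheory GRing.Theory Num.Theory.
Import numFieldNormedType.Exports.

Local Open Scope classical_set_scope.
Local Open Scope ring_scope.

Lemma psumr_nat_gt0 (R : realType) (a : nat -> R) t : (1 <= t)%N ->
  (forall j, (1 <= j)%N -> 0 < a j) -> 0 < \sum_(1 <= j < t.+1) a j.
Proof.
case: t => // t _ a_gt0; rewrite big_nat_recr //=; apply: ltr_wpDl; last exact: a_gt0.
by rewrite big_nat_cond; apply: sumr_ge0 => j /andP[/andP[? _] _]; rewrite ltW ?a_gt0.
Qed.

(** * Euclidean inner product and norm on row vectors *)

Section dotp_theory.
Variables (R : realType) (d : nat).
Implicit Types (u v w : 'rV[R]_d) (a : R).

Lemma dotpC u v : dotp u v = dotp v u.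
Proof. by apply: eq_bigr => k _; rewrite mulrC. Qed.

Lemma dotpDl u v w : dotp (u + v) w = dotp u w + dotp v w.
Proof. by rewrite -big_split; apply: eq_bigr => k _; rewrite mxE mulrDl. Qed.

Lemma dotpZl a u v : dotp (a *: u) v = a * dotp u v.
Proof. by rewrite mulr_sumr; apply: eq_bigr => k _; rewrite mxE mulrA. Qed.

Lemma dotpNl u v : dotp (- u) v = - dotp u v.
Proof. by rewrite -scaleN1r dotpZl mulN1r. Qed.

Lemma dotpDr u v w : dotp u (v + w) = dotp u v + dotp u w.
Proof. by rewrite ![dotp u _]dotpC dotpDl. Qed.

Lemma dotpZr a u v : dotp u (a *: v) = a * dotp u v.
Proof. by rewrite ![dotp u _]dotpC dotpZl. Qed.

Lemma dotpNr u v : dotp u (- v) = - dotp u v.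
Proof. by rewrite ![dotp u _]dotpC dotpNl. Qed.

Definition dotpE := (dotpDl, dotpDr, dotpNl, dotpNr, dotpZl, dotpZr).

Lemma dotp0l v : dotp 0 v = 0.
Proof. by rewrite -(scale0r 0) dotpZl mul0r. Qed.

Lemma dotpvv_ge0 u : 0 <= dotp u u.
Proof. by apply: sumr_ge0 => k _; rewrite -expr2 sqr_ge0. Qed.

Lemma l2norm_sqr u : l2norm u ^+ 2 = dotp u u.
Proof. by rewrite sqr_sqrtr // dotpvv_ge0. Qed.

Lemma l2norm_ge0 u : 0 <= l2norm u.
Proof. exact: sqrtr_ge0. Qed.

Lemma l2normN u : l2norm (- u) = l2norm u.
Proof. by rewrite /l2norm dotpNl dotpNr opprK. Qed.

Lemma l2norm_distC u v : l2norm (u - v) = l2norm (v - u).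
Proof. by rewrite -l2normN opprB. Qed.

Lemma coord_le_l2norm u k : `|u 0 k| <= l2norm u.
Proof.
rewrite -sqrtr_sqr; apply: ler_wsqrtr.
rewrite /dotp (bigD1 k) //= -expr2 lerDl.
by apply: sumr_ge0 => i _; rewrite -expr2 sqr_ge0.
Qed.

Lemma l2norm_eq0 u : l2norm u = 0 -> u = 0.
Proof.
move=> u0; apply/rowP => k; rewrite mxE; apply/eqP.
by rewrite -normr_le0 -u0 coord_le_l2norm.
Qed.

Lemma l2normZ a u : l2norm (a *: u) = `|a| * l2norm u.
Proof. by rewrite /l2norm !dotpE mulrA -expr2 sqrtrM ?sqr_ge0// sqrtr_sqr. Qed.

(** Cauchy-Schwarz: expand the nonnegative square of [l2norm v *: u - l2norm u *: v] and cancel the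
    product of the two norms, the zero vectors being treated apart. *)
Lemma dotp_le_l2norm u v : dotp u v <= l2norm u * l2norm v.
Proof.
have [/l2norm_eq0 ->|u0] := eqVneq (l2norm u) 0.
  by rewrite dotp0l mulr_ge0 ?l2norm_ge0.
have [/l2norm_eq0 ->|v0] := eqVneq (l2norm v) 0.
  by rewrite dotpC dotp0l mulr_ge0 ?l2norm_ge0.
have u_gt0 : 0 < l2norm u by rewrite lt_def u0 l2norm_ge0.
have v_gt0 : 0 < l2norm v by rewrite lt_def v0 l2norm_ge0.
have := dotpvv_ge0 (l2norm v *: u - l2norm u *: v).
rewrite !dotpE (dotpC v u) -!l2norm_sqr => h.
rewrite -(ler_pM2l (mulr_gt0 u_gt0 v_gt0)); nra.
Qed.

Lemma l2norm_sqrD u v : l2norm (u + v) ^+ 2 =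
  l2norm u ^+ 2 + 2 * dotp u v + l2norm v ^+ 2.
Proof. rewrite !l2norm_sqr !dotpE (dotpC v u); ring. Qed.

Lemma l2norm_continuous : continuous (@l2norm R d).
Proof.
move=> u; apply: (@continuous_comp _ _ _ (fun v => dotp v v) Num.sqrt);
  last exact: sqrt_continuous.
have -> : (fun v : 'rV[R]_d => dotp v v) = \sum_(k < d) (fun v => v 0 k * v 0 k).
  by apply/funext => v; rewrite fct_sumE.
elim/big_ind : _ => [|g h cg ch|k _]; first exact: cst_continuous.
- exact: continuousD.
- by apply: continuousM; exact: coord_continuous.
Qed.

End dotp_theory.

(** * Euclidean projection onto a closed convex set *)

Section projection.
Variables (R : realType) (d : nat) (W : set 'rV[R]_d).

(** The distance to [x] attains its minimum on the compact part of [W] inside a box around [x] whose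
    half-side [r] is the distance to a known point [u0]. Points of [W] farther than [r] lose to
    [u0], which lies in the box. *)
Lemma proj_exists (x : 'rV[R]_d) : W !=set0 -> closed W ->
  W (Defs.proj W x) /\ forall u, W u -> l2norm (x - Defs.proj W x) <= l2norm (x - u).
Proof.
move=> [u0 Wu0] Wc; suff : [set p | W p /\
    forall u, W u -> l2norm (x - p) <= l2norm (x - u)] !=set0.
  by move=> /(xgetPex 0).
pose r := l2norm (x - u0).
pose box := [set v : 'rV[R]_d | forall i, v ord0 i \in `[x ord0 i - r, x ord0 i + r]].
have boxE v : l2norm (x - v) <= r -> box v.
  move=> vr i; have := le_trans (coord_le_l2norm (x - v) i) vr.
  rewrite !mxE in_itv /= ler_norml => /andP[? ?]; apply/andP; split; lra.
have box_compact : compact box.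
  apply: (@rV_compact _ _ (fun i => `[x ord0 i - r, x ord0 i + r]%classic)).
  by move=> i; exact: segment_compact.
have K_compact : compact (box `&` W) by exact: compact_closedI.
have Ku0 : (box `&` W) u0 by split => //; exact: boxE.
have xc : continuous (fun u : 'rV[R]_d => l2norm (x - u)).
  move=> u; apply: (@continuous_comp 'rV[R]_d 'rV[R]_d R (fun u => x - u));
    last exact: l2norm_continuous.
  by apply: continuousB; [exact: cst_continuous | by move=> ?; exact: cvg_id].
have [p] := EVT_min_rV (ex_intro _ u0 Ku0) K_compact (continuous_subspaceT xc).
rewrite inE => -[_ Wp] pmin; exists p; split=> // u Wu.
have [ur|/ltW ru] := leP (l2norm (x - u)) r.
  by apply: pmin; rewrite inE; split => //; exact: boxE.
by apply: le_trans ru; apply: pmin; rewrite inE.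
Qed.

Hypothesis Wconvex : @convex_set R 'rV[R]_d W.

Lemma convex_set_comb (u v : 'rV[R]_d) (s : R) : W u -> W v -> 0 <= s <= 1 ->
  W (s *: u + (1 - s) *: v).
Proof.
move=> Wu Wv /andP[s0 s1].
have := @Wconvex u v (Itv01 s0 s1).
by rewrite !inE; apply.
Qed.

Lemma convex_set_segment (u v : 'rV[R]_d) (s : R) : W u -> W v -> 0 <= s <= 1 ->
  W (u + s *: (v - u)).
Proof.
move=> Wu Wv s01; have := convex_set_comb Wv Wu s01; congr (W _).
by rewrite scalerBr scalerBl scale1r addrCA.
Qed.

Lemma convex_set_barycenter (a : nat -> R) (x : nat -> 'rV[R]_d) (t : nat) :
  (1 <= t)%N -> (forall j, (1 <= j)%N -> 0 < a j) -> (forall j, W (x j)) ->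
  W ((\sum_(1 <= j < t.+1) a j)^-1 *: \sum_(1 <= j < t.+1) a j *: x j).
Proof.
move=> + a_gt0 Wx; elim: t => [//|[|t] IH _].
  by rewrite !big_nat1 scalerA mulVf ?scale1r // gt_eqF // a_gt0.
rewrite big_nat_recr //= [X in _ *: X]big_nat_recr //=.
set A := \sum_(1 <= j < t.+2) a j in IH *; set X := \sum_(1 <= j < t.+2) a j *: x j in IH *.
have A_gt0 : 0 < A by exact: psumr_nat_gt0.
have a2 := a_gt0 t.+2 isT.
have Aa : 0 < A + a t.+2 by rewrite addr_gt0.
(* The barycenter of one point more is a convex combination of the previous barycenter and the new
   point. *)
have := @convex_set_comb _ (x t.+2) (A / (A + a t.+2)) (IH isT) (Wx _).
have -> : 1 - A / (A + a t.+2) = (A + a t.+2)^-1 * a t.+2.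
  by field; rewrite gt_eqF.
have -> : A / (A + a t.+2) *: (A^-1 *: X) = (A + a t.+2)^-1 *: X.
  rewrite scalerA; congr (_ *: _); field; rewrite !gt_eqF //.
rewrite -scalerA -scalerDr; apply.
by rewrite divr_ge0 ?ltW //= ltr_pdivrMr // mul1r ltrDl.
Qed.

Hypotheses (Wn0 : W !=set0) (Wclosed : closed W).

Lemma proj_in (x : 'rV[R]_d) : W (Defs.proj W x).
Proof. by have [] := proj_exists x Wn0 Wclosed. Qed.

(** The obtuse angle criterion: at a positive inner product, moving from the projection slightly
    towards [u] would come closer to [x]. *)
Lemma proj_variational (x u : 'rV[R]_d) : W u ->
  dotp (x - Defs.proj W x) (u - Defs.proj W x) <= 0.
Proof.
move=> Wu; have [Wp pmin] := proj_exists x Wn0 Wclosed.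
set p := Defs.proj W x in Wp pmin *; rewrite leNgt; apply/negP => c_gt0.
set c := dotp _ _ in c_gt0; pose D := l2norm (u - p) ^+ 2.
have D_ge0 : 0 <= D by exact: sqr_ge0.
(* With this step [s * D < c], so the change [s ^+ 2 * D - 2 * s * c] of the squared distance to [x]
   is negative; [s <= 1] keeps the point in [W]. *)
pose s := c / (D + c).
have Dc : 0 < D + c by rewrite ltr_wpDl.
have s_gt0 : 0 < s by rewrite divr_gt0.
have s_le1 : s <= 1 by rewrite ler_pdivrMr // mul1r lerDr.
have := pmin _ (convex_set_segment Wp Wu (_ : 0 <= s <= 1)).
rewrite s_le1 ltW // => /(_ isT).
rewrite -(ler_pXn2r (_ : 0 < 2)%N) ?nnegrE ?l2norm_ge0 //.
rewrite [X in _ <= l2norm X ^+ 2](_ : _ = (x - p) + (- s) *: (u - p)); last first.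
  by rewrite scaleNr opprD addrA.
rewrite l2norm_sqrD dotpZr l2normZ -/c exprMn -/D normrN real_normK ?num_real //.
have sE : s * (D + c) = c by rewrite /s divfK // gt_eqF.
by move: s_gt0 c_gt0 sE D_ge0; nra.
Qed.

End projection.

(** * One projected gradient step *)

Section descent.
Variables (R : realType) (d : nat) (W : set 'rV[R]_d) (G : R).
Hypothesis Wconvex : @convex_set R 'rV[R]_d W.

(* Only directions pointing into W matter, which is why this holds for a true
   gradient although its norm may exceed G when w is on the boundary of W. *)
Lemma loss_gradient_lipschitz (h : 'rV[R]_d -> R) (w g u : 'rV[R]_d) :
  (forall x y, W x -> W y -> `|h x - h y| <= G * l2norm (x - y)) ->
  loss_gradient W G h w g -> W w -> W u ->
  - dotp g (u - w) <= G * l2norm (u - w).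
Proof.
move=> hG hg Ww Wu.
have line_cvg (v : 'rV[R]_d) : w + s *: v @[s --> 0^'+] --> w.
  apply: cvg_at_right_filter; rewrite -[X in _ --> X]addr0 -(scale0r v).
  by apply: cvgD; [exact: cvg_cst | apply: cvgZr_tmp; exact: cvg_id].
have near_line (v : 'rV[R]_d) (Q : 'rV[R]_d -> Prop) : (\forall x \near w, Q x) ->
    exists s : R, [/\ 0 < s, s <= 1 & Q (w + s *: v)].
  move=> Qw.
  have Q0 : \forall s \near 0^'+, Q (w + s *: v) by exact: (line_cvg v _ Qw).
  near (0 : R)^'+ => s; exists s; split.
  - by near: s; exact: nbhs_right_gt.
  - by near: s; apply: nbhs_right_le.
  - by near: s.
have lin s : dotp g (s *: (u - w)) = s * dotp g (u - w) by rewrite dotpZr.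
case: hg => [hg|[hg [wW|gG]]].
(* True gradient: difference quotients along the segment from [w] to [u], which stays in [W]. The
   tolerance [e / (L + 1)] also covers [L = 0]. *)
- apply/ler_addgt0Pr => e e_gt0.
  pose L := l2norm (u - w); have L0 : 0 <= L := l2norm_ge0 _.
  have L1 : 0 < L + 1 by rewrite ltr_wpDl.
  have [s [s_gt0 s_le1 hs]] := near_line (u - w) _ (hg (e / (L + 1)) (divr_gt0 e_gt0 L1)).
  have Ws : W (w + s *: (u - w)) by apply: convex_set_segment => //; rewrite ltW.
  have := hG _ _ Ws Ww; have := hs Ws.
  rewrite [w + _ - w]addrAC subrr add0r lin l2normZ (gtr0_norm s_gt0) -/L.
  rewrite !ler_norml => /andP[_ h1] /andP[h2 _].
  have eL : e / (L + 1) * L <= e.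
    by rewrite mulrAC ler_pdivrMr // ler_wpM2l ?ltW ?ltrDl.
  rewrite -(ler_pM2l s_gt0).
  have : s * (e / (L + 1) * L) <= s * e by rewrite ler_pM2l.
  nra.
(* Subgradient at an interior point: test it at a point of [W] on the side of [w] opposite to
   [u]. *)
- have [s [s_gt0 _ Ws]] := near_line (- (u - w)) _ wW.
  have := hg _ Ws; have := hG _ _ Ws Ww.
  rewrite [w + _ - w]addrAC subrr add0r scalerN dotpNr lin l2normN l2normZ.
  rewrite (gtr0_norm s_gt0) ler_norml => /andP[_ h1] h2.
  by rewrite -(ler_pM2l s_gt0); nra.
- rewrite -dotpNl; apply: le_trans (dotp_le_l2norm _ _) _.
  by rewrite l2normN ler_wpM2r ?l2norm_ge0.
Unshelve. all: by end_near. Qed.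

Hypotheses (Wn0 : W !=set0) (Wclosed : closed W).
Variables (eta : R) (v g : 'rV[R]_d).
Hypotheses (eta_ge0 : 0 <= eta) (Wv : W v).
Hypothesis gG : forall u, W u -> - dotp g (u - v) <= G * l2norm (u - v).

Let p := Defs.proj W (v - eta *: g).

Let Wp : W p. Proof. exact: proj_in. Qed.

(** The variational inequality compared with [v] itself gives [x ^+ 2 <= eta * G * x] for the length
    [x] of the step. This bounds the change of a loss over one step. *)
Lemma proj_step_small : G * l2norm (p - v) <= eta * G ^+ 2.
Proof.
have := proj_variational Wconvex Wn0 Wclosed (v - eta *: g) Wv; rewrite -/p.
have -> : v - eta *: g - p = - (p - v) - eta *: g.
  by rewrite addrAC opprB.
have -> : v - p = - (p - v) by rewrite opprB.
move: (l2norm_ge0 (p - v)) (gG Wp); move: (p - v) => a.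
rewrite !dotpE -l2norm_sqr; set x := l2norm a => x0 gx h.
have {}gx : x * x <= eta * G * x.
  have := ler_wpM2l eta_ge0 gx.  nra.
have [->|xn0] := eqVneq x 0; first by rewrite mulr0 mulr_ge0 ?sqr_ge0.
have x_gt0 : 0 < x by rewrite lt_def xn0.
rewrite ler_pM2r // in gx.
(* The sign of [G] is not known here; for negative [G] the left-hand side is nonpositive. *)
have [G0|G0] := leP 0 G; first by rewrite expr2; nra.
have : G * x <= 0 by rewrite mulr_le0_ge0 // ltW.
by move=> /le_trans; apply; rewrite mulr_ge0 ?sqr_ge0.
Qed.

(** As [l2norm g] may exceed [G], nonexpansiveness of the projection would not give the last term.
    The variational inequality keeps a term [- l2norm (p - v) ^+ 2], which together with
    [2 * eta * G * l2norm (p - v)] is at most [eta ^+ 2 * G ^+ 2] by completing the square. *)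
Lemma proj_step_descent (w : 'rV[R]_d) : W w ->
  l2norm (p - w) ^+ 2 <=
    l2norm (v - w) ^+ 2 + 2 * eta * dotp g (w - v) + eta ^+ 2 * G ^+ 2.
Proof.
move=> Ww; have := proj_variational Wconvex Wn0 Wclosed (v - eta *: g) Ww.
rewrite -/p.
have -> : v - eta *: g - p = - (p - v) - eta *: g.
  by rewrite addrAC opprB.
have -> : w - p = - (p - v) - (v - w).
  by rewrite !opprB [RHS]addrC subrKA.
have -> : w - v = - (v - w) by rewrite opprB.
have -> : p - w = (p - v) + (v - w) by rewrite subrKA.
have := gG Wp; have := eta_ge0.
rewrite l2norm_sqrD; move: (p - v) (v - w) => a b.
rewrite !dotpE !opprK -!l2norm_sqr => e0 ga h.
have sq : 0 <= (l2norm a - eta * G) ^+ 2 by exact: sqr_ge0.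
have := ler_wpM2l e0 ga; rewrite dotpC (dotpC g b) in h *.
nra.
Qed.

End descent.

(** * Hoeffding's lemma for the uniform law on a finite set *)

Section hoeffding.
Variable R : realType.
Implicit Types (a mu s c : R).

Lemma ge0_is_derive_le (f df : R -> R) a : (forall x : R, is_derive x 1 f (df x)) ->
  (forall x, 0 <= x -> 0 <= df x) -> 0 <= a -> f 0 <= f a.
Proof.
move=> fdf df_ge0 a_ge0.
have fd x : derivable f x 1 by case: (fdf x).
apply: (@ger0_derive1_ndecry _ f 0) => // [x|].
  rewrite in_itv /= andbT => /ltW x0.
  by rewrite derive1E; have -> := @derive_val _ _ _ _ _ _ _ (fdf x); exact: df_ge0.
apply: continuous_subspaceT => x.
by apply/differentiable_continuous/derivable1_diffP.
Qed.

(* The logarithmic derivative of the left-hand side is the hyperbolic tangent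
   of a shift of a, whose derivative is at most 1. *)
Lemma two_point_mgf_le mu a : -1 <= mu <= 1 -> 0 <= a ->
  (1 - mu) * expR a + (1 + mu) * expR (- a) <= 2 * expR (a ^+ 2 / 2 - mu * a).
Proof.
move=> /andP[mu_ge mu_le] a_ge0.
pose c x := (1 - mu) * expR x + (1 + mu) * expR (- x).
pose s x := (1 - mu) * expR x - (1 + mu) * expR (- x).
have c_gt0 x : 0 < c x.
  have e1 := expR_gt0 x; have e2 := expR_gt0 (- x); rewrite /c.
  have [->|m1] := eqVneq mu 1; first by rewrite subrr mul0r add0r mulr_gt0.
  have {}m1 : mu < 1 by rewrite lt_neqAle m1.
  by rewrite ltr_pwDl ?mulr_gt0 ?mulr_ge0 ?(ltW e2) ?subr_gt0 // -lerBlDl sub0r.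
have dE (x : R) : is_derive x 1 (fun x => expR (- x)) (- expR (- x)).
  have := @is_derive1_comp _ expR -%R x _ _ (is_derive_expR _) (is_deriveN (is_derive_id x 1)).
  by rewrite mulrN1.
have dc (x : R) : is_derive x 1 c (s x).
  have := is_deriveD (is_deriveZ (1 - mu) (is_derive_expR x)) (is_deriveZ (1 + mu) (dE x)).
  by rewrite /s -mulrN.
have ds (x : R) : is_derive x 1 s (c x).
  have := is_deriveB (is_deriveZ (1 - mu) (is_derive_expR x)) (is_deriveZ (1 + mu) (dE x)).
  by rewrite /c /GRing.scale /= mulrN opprK.
have c0 : c 0 = 2 by rewrite /c oppr0 expR0; ring.
have s0 : s 0 = - 2 * mu by rewrite /s oppr0 expR0; ring.
(* Since [s] and [c] are derivatives of each other, [s / c] has derivative [1 - (s / c) ^+ 2]; hence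
   [phi] is nondecreasing, and it vanishes at 0. *)
have tanh_le x : 0 <= x -> s x / c x <= x - mu.
  move=> x_ge0; pose phi x := x - mu - s x / c x.
  have dphi (y : R) : is_derive y 1 phi ((s y / c y) ^+ 2).
    have cn0 : c y != 0 by rewrite gt_eqF.
    have := is_deriveB (is_deriveB (is_derive_id y 1) (is_derive_cst mu y 1))
      (is_deriveM (ds y) (is_deriveV cn0 (dc y))).
    rewrite /GRing.scale /= => h.
    by apply: (is_derive_eq h); field.
  have := ge0_is_derive_le dphi (fun y _ => sqr_ge0 _) x_ge0.
  have -> : phi 0 = 0 by rewrite /phi s0 c0; field.
  by rewrite /phi subr_ge0.
pose psi x := x ^+ 2 / 2 - mu * x - ln (c x).
have dpsi (x : R) : is_derive x 1 psi (x - mu - s x / c x).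
  have dln := @is_derive1_comp _ (@ln R) c x _ _ (is_derive1_ln (c_gt0 x)) (dc x).
  have := is_deriveB (is_deriveB (is_deriveM (is_deriveM (is_derive_id x 1) (is_derive_id x 1))
    (is_derive_cst (2^-1 : R) x 1)) (is_deriveZ mu (is_derive_id x 1))) dln.
  rewrite /GRing.scale /= => h; apply: (is_derive_eq h).
  have cn0 : c x != 0 by rewrite gt_eqF.
  by field.
have psi_ge0 x : 0 <= x -> 0 <= x - mu - s x / c x.
  by move=> x0; rewrite subr_ge0 tanh_le.
have := ge0_is_derive_le dpsi psi_ge0 a_ge0.
rewrite /psi c0 expr0n /= mul0r mulr0 subr0 sub0r => h.
rewrite -/(c a) -ler_pdivrMl // -ler_ln ?posrE ?mulr_gt0 ?invr_gt0 ?expR_gt0 //.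
by rewrite expRK lnM ?posrE ?invr_gt0 // lnV ?posrE //; lra.
Qed.

(** Convexity of the exponential between [- (s * c)] and [s * c]. *)
Lemma expR_le_chord c s (x : R) : 0 < c -> `|x| <= c ->
  expR (s * x) <= (c + x) / (2 * c) * expR (s * c) + (c - x) / (2 * c) * expR (- (s * c)).
Proof.
move=> c_gt0; rewrite ler_norml => /andP[cx xc].
have c2 : 0 < 2 * c by rewrite mulr_gt0.
have t0 : 0 <= (c + x) / (2 * c) by rewrite divr_ge0 ?(ltW c2) //; lra.
have t1 : (c + x) / (2 * c) <= 1 by rewrite ler_pdivrMr //; lra.
have := @convex_expR R (Itv01 t0 t1) (s * c) (- (s * c)).
rewrite !convRE /= /unstable.onem.
have -> : 1 - (c + x) / (2 * c) = (c - x) / (2 * c) by field; rewrite gt_eqF.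
apply: le_trans; rewrite le_eqVlt; apply/orP; left; apply/eqP; congr expR.
by field; rewrite gt_eqF.
Qed.

(** The chord bound is affine in [x k], so its sum over [k] depends on [x] only through the mean
    [m]; what remains is the two-point law on [c] and [- c], with [mu = m / c]. *)
Lemma hoeffding_finite (K : finType) (x : K -> R) (c s : R) :
  (0 < #|K|)%N -> 0 <= s -> (forall k, `|x k| <= c) ->
  \sum_k expR (s * (#|K|%:R^-1 * (\sum_k' x k') - x k)) <=
    #|K|%:R * expR ((s * c) ^+ 2 / 2).
Proof.
move=> K0 s0 xc; set N : R := #|K|%:R; set m := N^-1 * _.
have N0 : 0 < N by rewrite ltr0n.
have /card_gt0P[k0 _] := K0.
have c_ge0 : 0 <= c := le_trans (normr_ge0 _) (xc k0).
have sumN (y : R) : \sum_(k : K) y = N * y by rewrite sumr_const mulr_natl.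
have mc : - c <= m <= c.
  rewrite /m; have sc (y : R) : N^-1 * (N * y) = y by rewrite mulKf // gt_eqF.
  have NV : 0 <= N^-1 by rewrite invr_ge0 ltW.
  apply/andP; split.
    rewrite -[X in X <= _]sc -sumN; apply: ler_wpM2l => //; apply: ler_sum => k _.
    by have := xc k; rewrite ler_norml => /andP[].
  rewrite -[X in _ <= X]sc -sumN; apply: ler_wpM2l => //; apply: ler_sum => k _.
  by have := xc k; rewrite ler_norml => /andP[].
(* The chord divides by [c]; for [c = 0] all values vanish and the bound is an equality. *)
move: c_ge0; rewrite le_eqVlt => /predU1P[c0|c_gt0].
  have x0 k : x k = 0 by apply/normr0_eq0/le_anti; rewrite {1}c0 xc normr_ge0.
  have m0 : m = 0 by move: mc; rewrite -c0 oppr0; move/le_anti.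
  under eq_bigr do rewrite m0 x0 subr0 mulr0 expR0.
  by rewrite sumN -c0 mulr0 expr0n /= mul0r expR0.
have step k : expR (s * (m - x k)) <= expR (s * m) *
   ((c - x k) / (2 * c) * expR (s * c) + (c + x k) / (2 * c) * expR (- (s * c))).
  have -> : s * (m - x k) = s * m + s * - x k by ring.
  rewrite expRD ler_pM2l ?expR_gt0 //.
  have := @expR_le_chord c s (- x k) c_gt0; rewrite normrN opprK; exact.
apply: le_trans (ler_sum _ (fun k _ => step k)) _.
have -> : \sum_k expR (s * m) * ((c - x k) / (2 * c) * expR (s * c) +
      (c + x k) / (2 * c) * expR (- (s * c))) = N * (expR (s * m) *
      ((c - m) / (2 * c) * expR (s * c) + (c + m) / (2 * c) * expR (- (s * c)))).
  have sx : \sum_k x k = N * m by rewrite /m mulVKf // gt_eqF.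
  rewrite -mulr_sumr big_split /= -!mulr_suml sumrB big_split /= !sumN sx.
  by ring.
rewrite ler_pM2l //.
have := @two_point_mgf_le (m / c) (s * c).
rewrite ler_pdivlMr // ler_pdivrMr // mulN1r mul1r mc mulr_ge0 ?(ltW c_gt0) // => /(_ isT isT) h.
have -> : (s * c) ^+ 2 / 2 = s * m + ((s * c) ^+ 2 / 2 - m / c * (s * c)).
  by field; rewrite gt_eqF.
rewrite expRD ler_pM2l ?expR_gt0 // -(ler_pM2l (_ : 0 < 2)) //.
apply: le_trans h; rewrite le_eqVlt; apply/orP; left; apply/eqP.
by field; rewrite gt_eqF.
Qed.

End hoeffding.

(** * Averages over index sequences and exponential supermartingales *)

Section resampling.
Variables (R : realType) (n : nat).
Implicit Types (b : nat -> 'I_n) (F : (nat -> 'I_n) -> R).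

Definition upd b (k : nat) (i : 'I_n) : nat -> 'I_n :=
  fun j => if j == k then i else b j.

(** Stands for measurability with respect to the first [k] draws. *)
Definition depends_below (A : Type) (k : nat) (h : (nat -> 'I_n) -> A) :=
  forall b b', (forall j, (j < k)%N -> b j = b' j) -> h b = h b'.

(* The conditional expectation of F given the coordinates below k, when F only
   depends on the coordinates below k + m. *)
Fixpoint avg (m k : nat) F b : R :=
  if m is m'.+1 then n%:R^-1 * \sum_(i < n) avg m' k.+1 F (upd b k i) else F b.

Lemma upd_below b k i j : (j < k)%N -> upd b k i j = b j.
Proof. by rewrite /upd => /ltn_eqF ->. Qed.

Lemma upd_eq b k i : upd b k i k = i.
Proof. by rewrite /upd eqxx. Qed.

Lemma depends_belowW (A : Type) k k' (h : (nat -> 'I_n) -> A) : (k <= k')%N ->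
  depends_below k h -> depends_below k' h.
Proof. by move=> kk' hk b b' bb'; apply: hk => j /leq_trans/(_ kk'); exact: bb'. Qed.

Lemma ler_avg m k F F' b : (forall b', F b' <= F' b') -> avg m k F b <= avg m k F' b.
Proof.
move=> FF'; elim: m k b => [|m IH] k b //=.
by rewrite ler_wpM2l ?invr_ge0 ?ler0n //; apply: ler_sum => i _.
Qed.

Lemma avgD m k F F' b :
  avg m k (fun b' => F b' + F' b') b = avg m k F b + avg m k F' b.
Proof.
elim: m k b => [|m IH] k b //=.
by rewrite -mulrDr -big_split /=; congr (_ * _); apply: eq_bigr => i _.
Qed.

(** Taking out what is known: resampling coordinates from [k] on does not change [h]. *)
Lemma avgM m k (h : (nat -> 'I_n) -> R) F b : depends_below k h ->
  avg m k (fun b' => h b' * F b') b = h b * avg m k F b.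
Proof.
elim: m k b => [|m IH] k b hk //=.
rewrite mulrCA; congr (_ * _); rewrite mulr_sumr; apply: eq_bigr => i _.
rewrite IH; last exact: depends_belowW hk.
by congr (_ * _); apply: hk => j; exact: upd_below.
Qed.

Lemma avgZ m k (a : R) F b : avg m k (fun b' => a * F b') b = a * avg m k F b.
Proof. exact: avgM. Qed.

Hypothesis n_gt0 : (0 < n)%N.

Let nR_neq0 : (n%:R : R) != 0. Proof. by rewrite pnatr_eq0 -lt0n. Qed.

Lemma avg_cst m k (a : R) b : avg m k (fun=> a) b = a.
Proof.
elim: m k b => [|m IH] k b //=.
under eq_bigr do rewrite IH.
by rewrite sumr_const card_ord -[a *+ n]mulr_natl mulKf.
Qed.

(* The increment z j is controlled given the coordinates below j.-1, two steps
   back, so only increments with indices of the same parity can be chained. *)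
Lemma avg_expR_parity (z : nat -> (nat -> 'I_n) -> R) :
  (forall j, depends_below j.+1 (z j)) ->
  (forall j b, \sum_(i < n) \sum_(i' < n)
     expR (z j.+1 (upd (upd b j i) j.+1 i')) <= n%:R ^+ 2) ->
  forall p m k b, (p.*2 <= m)%N ->
  avg m k (fun b' => expR (\sum_(q < p) z (k + q.*2.+1)%N b')) b <= 1.
Proof.
move=> zdep zle; elim=> [|p IH] m k b.
  move=> _; rewrite -[X in _ <= X](avg_cst m k 1 b).
  by apply: ler_avg => b'; rewrite big_ord0 expR0.
case: m => [|[|m]] //; rewrite doubleS !ltnS => pm /=.
have nn : n%:R^-1 * (n%:R^-1 * n%:R ^+ 2) = 1 :> R by rewrite expr2 mulKf // mulVf.
have nV : 0 <= n%:R^-1 :> R by rewrite invr_ge0 ler0n.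
rewrite -[X in _ <= X]nn -mulr_sumr; do 2!(apply: ler_wpM2l => //).
apply: le_trans (zle k b); apply: ler_sum => i _; apply: ler_sum => i' _.
set b' := upd _ _ _.
(* Peel off the first term. It is fixed once coordinates [k] and [k.+1] are drawn, so it leaves the
   inner average, and the induction hypothesis applies from [k.+2] on. *)
have -> : (fun b0 : nat -> 'I_n => expR (\sum_(q < p.+1) z (k + q.*2.+1)%N b0)) =
    (fun b0 => expR (z k.+1 b0) * expR (\sum_(q < p) z (k.+2 + q.*2.+1)%N b0)).
  apply/funext => b0; rewrite big_ord_recl -expRD /= addn1; congr (expR (_ + _)).
  by apply: eq_bigr => q _; rewrite /bump /= add1n doubleS !addSn !addnS.
rewrite avgM; last by move=> b1 b2 b12; rewrite (zdep k.+1 b1 b2).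
by rewrite -[X in _ <= X]mulr1 ler_pM2l ?expR_gt0 //; exact: IH.
Qed.

Lemma sum_odd_even (y : nat -> R) t : \sum_(1 <= j < t.+1) y j =
  \sum_(q < uphalf t) y q.*2.+1 + \sum_(q < t./2) y q.*2.+2.
Proof.
elim: t => [|t IH]; first by rewrite big_nil !big_ord0 addr0.
rewrite big_nat_recr //= {}IH uphalf_half.
have := odd_double_half t; case: (odd t) => /= tE.
  rewrite add1n in tE *; rewrite [X in _ = _ + X]big_ord_recr /= addrA.
  by rewrite -doubleS; congr (_ + y _); rewrite -[in LHS]tE.
rewrite add0n in tE *; rewrite [X in _ = X + _]big_ord_recr /= addrAC.
by rewrite tE.
Qed.

(** The factor 2 in the hypothesis pays for recombining the parities: [expR (A + E)] is at most the
    mean of [expR (2 * A)] and [expR (2 * E)]. *)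
Lemma avg_expR_sum (y : nat -> (nat -> 'I_n) -> R) t m b :
  (forall j, depends_below j.+1 (y j)) ->
  (forall j b, \sum_(i < n) \sum_(i' < n)
     expR (2 * y j.+1 (upd (upd b j i) j.+1 i')) <= n%:R ^+ 2) ->
  (t < m)%N -> avg m 0 (fun b' => expR (\sum_(1 <= j < t.+1) y j b')) b <= 1.
Proof.
move=> ydep yle tm; pose z j b := 2 * y j b.
have zdep j : depends_below j.+1 (z j) by move=> b1 b2 b12; rewrite /z (ydep j b1 b2).
pose Fo b := expR (\sum_(q < uphalf t) z (0 + q.*2.+1)%N b).
pose Fe b := expR (\sum_(q < t./2) z (1 + q.*2.+1)%N b).
have amgm b' : expR (\sum_(1 <= j < t.+1) y j b') <= 2^-1 * (Fo b' + Fe b').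
  rewrite sum_odd_even /Fo /Fe /z -!mulr_sumr expRD.
  under [X in expR (2 * X) + _]eq_bigr do rewrite add0n.
  under [X in _ + expR (2 * X)]eq_bigr do rewrite add1n.
  set A := \sum_(q < _) _; set E := \sum_(q < _) _.
  rewrite !(mulrDl 1 1) !mul1r !expRD.
  have := sqr_ge0 (expR A - expR E); nra.
apply: le_trans (ler_avg _ _ _ amgm) _; rewrite avgZ avgD.
have od : avg m 0 Fo b <= 1.
  apply: avg_expR_parity => //; apply: leq_trans tm.
  by rewrite uphalf_half doubleD; have := odd_double_half t; case: (odd t); lia.
(* The even chain starts at coordinate 1, so coordinate 0 is averaged out first; the bound holds for
   each of its values. *)
have ev : avg m 0 Fe b <= 1.
  case: m tm {od} => // m; rewrite ltnS => tm /=.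
  rewrite -[X in _ <= X](mulVf nR_neq0) ler_wpM2l ?invr_ge0 ?ler0n //.
  rewrite -[X in _ <= X%:R](card_ord n) -sumr_const; apply: ler_sum => i _.
  apply: avg_expR_parity => //; apply: leq_trans tm.
  by have := odd_double_half t; case: (odd t); lia.
lra.
Qed.

End resampling.

(** * From averages to probabilities of events of the iid indices *)

Section iid.
Variables (R : realType) (dsp : measure_display) (Om : measurableType dsp).
Variables (P : probability Om R) (n : nat) (I : nat -> Om -> 'I_n).
Hypotheses (n_gt0 : (0 < n)%N) (Iiid : iid_uniform P I).

(** Backward recursion on the number [k] of prescribed draws: if all [T] are prescribed,
    independence gives the mass of a cylinder; otherwise the event is partitioned by the value of
    draw [k]. The case [k = 0] is the probability of [Q]. *)
Lemma iid_uniform_avg (Q : (nat -> 'I_n) -> bool) T m k b :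
  depends_below T Q -> (k + m)%N = T ->
  let A := [set om | Q (I ^~ om) /\ forall j, (j < k)%N -> I j om = b j] in
  measurable A /\ P A = ((n%:R ^+ k)^-1 * avg m k (fun b' => (Q b')%:R) b)%:E.
Proof.
have [mI PI indepI] := Iiid.
move=> Qdep; elim: m k b => [|m IH] k b.
  rewrite addn0 => -> /=.
  have cylE : [set om | Q (I ^~ om) /\ forall j, (j < T)%N -> I j om = b j] =
      if Q b then \bigcap_(j in [set` iota 0 T]) (I j @^-1` [set b j]) else set0.
    case: ifPn => Qb; apply/seteqP; split => om //=.
    - by move=> [_ IT] j /=; rewrite mem_iota add0n => /IT.
    - move=> IT; have {}IT j : (j < T)%N -> I j om = b j.
        by move=> jT; apply: IT; rewrite /= mem_iota.
      by rewrite (Qdep _ b).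
    - by move=> [+ IT]; rewrite (Qdep _ b) // (negbTE Qb).
  rewrite cylE; case: ifPn => Qb; last by rewrite measure0 mulr0.
  split.
    by apply: fin_bigcap_measurable => // j _; exact: mI.
  rewrite indepI ?iota_uniq //.
  rewrite (eq_bigr (fun=> (n%:R^-1)%:E)) => [|j _]; last exact: PI.
  rewrite big_const_seq count_predT size_iota mulr1 -exprVn.
  by elim: T {cylE Qdep} => [|T IHT] /=; rewrite ?expr0 // IHT exprS.
rewrite addnS -addSn => /IH{}IH /=.
pose B i := [set om | Q (I ^~ om) /\ forall j, (j < k.+1)%N -> I j om = upd b k i j].
have BE : [set om | Q (I ^~ om) /\ forall j, (j < k)%N -> I j om = b j] =
    \big[setU/set0]_(i < n) B i.
  rewrite -bigcup_seq; apply/seteqP; split => [om /= [Qom Ib]|om].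
    exists (I k om); rewrite /= ?mem_index_enum //; split=> // j.
    rewrite ltnS leq_eqVlt => /predU1P[->|jk]; first by rewrite upd_eq.
    by rewrite upd_below // Ib.
  move=> [i _ [Qom Ib]]; split=> // j jk.
  by rewrite Ib ?(ltn_trans jk) // upd_below.
rewrite BE; split.
  by apply: bigsetU_measurable => i _; have [] := IH (upd b k i).
rewrite measure_bigsetU_ord //; first last.
- by apply/trivIsetP => i j _ _ ij; apply/seteqP; split=> // om [[_ Bi] [_ Bj]];
    move/eqP: ij; apply; have := Bi k (ltnSn k); rewrite (Bj k (ltnSn k)) !upd_eq.
- by move=> i; have [] := IH (upd b k i).
rewrite (eq_bigr (fun i => ((n%:R ^+ k.+1)^-1 *
   avg m k.+1 (fun b' => (Q b')%:R) (upd b k i))%:E)) => [|i _]; last first.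
  by have [] := IH (upd b k i).
by rewrite sumEFin -mulr_sumr exprS invfM -mulrA mulrCA mulrA.
Qed.

(** Markov's inequality for the exponential of the sum of the [y j], whose mean is at most 1. *)
Lemma iid_uniform_tail (Q : (nat -> 'I_n) -> bool) T
    (y : nat -> (nat -> 'I_n) -> R) t (delta : R) :
  depends_below T Q -> (forall j, depends_below j.+1 (y j)) ->
  (forall j b, \sum_(i < n) \sum_(i' < n)
     expR (2 * y j.+1 (upd (upd b j i) j.+1 i')) <= n%:R ^+ 2) ->
  0 < delta ->
  (forall b, \sum_(1 <= j < t.+1) y j b <= ln (1 / delta) -> Q b) ->
  ((1 - delta)%:E <= P [set om | Q (I ^~ om)])%E.
Proof.
move=> Qdep ydep yle delta_gt0 yQ.
pose b0 : nat -> 'I_n := fun=> Ordinal n_gt0.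
(* The horizon is enlarged so as to cover both [Q] and the [t] summands. *)
have QdepT : depends_below (T + t.+1) Q by apply: depends_belowW Qdep; exact: leq_addr.
have [_] := @iid_uniform_avg Q _ _ _ b0 QdepT (add0n _).
have -> : [set om | Q (I ^~ om) /\ forall j, (j < 0)%N -> I j om = b0 j] =
    [set om | Q (I ^~ om)] by apply/seteqP; split => om //= [].
move=> ->; rewrite expr0 invr1 mul1r lee_fin.
(* Where the exponential is at most [1 / delta], [Q] holds; elsewhere the left-hand side is
   negative. *)
have markov b : 1 + - delta * expR (\sum_(1 <= j < t.+1) y j b) <= (Q b)%:R.
  have e_gt0 := expR_gt0 (\sum_(1 <= j < t.+1) y j b).
  have [/yQ ->|] := leP (\sum_(1 <= j < t.+1) y j b) (ln (1 / delta)).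
    by rewrite gerDl mulNr oppr_le0 mulr_ge0 ?ltW.
  rewrite -ltr_expR lnK ?posrE ?divr_gt0 // ltr_pdivrMr // mulrC => h.
  apply: (@le_trans _ _ 0); last exact: ler0n.
  by rewrite mulNr subr_le0 ltW.
apply: le_trans (ler_avg _ _ _ markov).
rewrite avgD avg_cst // avgZ lerD2l -[X in X <= _]mulr1 ler_wnM2l ?oppr_le0 ?(ltW delta_gt0) //.
by apply: avg_expR_sum => //; rewrite addnS ltnS leq_addl.
Qed.

End iid.

(** * SGD on a fixed dataset: descent, convexity of the risk, noise *)

Section sgd_analysis.
Variables (R : realType) (d : nat) (W : set 'rV[R]_d) (Z : Type).
Variables (f : 'rV[R]_d -> Z -> Z -> R) (gradf : 'rV[R]_d -> Z -> Z -> 'rV[R]_d).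
Variables (alpha G : R) (n : nat) (z : 'I_n -> Z).
Variables (eta : nat -> R) (w0 : 'rV[R]_d).
Hypotheses (Wn0 : W !=set0) (Wclosed : closed W) (Wconvex : @convex_set R 'rV[R]_d W).
Hypothesis fgrad : forall w y y', W w ->
  loss_gradient W G (fun u => f u y y') w (gradf w y y').
Hypothesis alpha_ge0 : 0 <= alpha.
Hypothesis flip : forall w w' y y', W w -> W w' ->
  `|f w y y' - f w' y y'| <= G * l2norm (w - w').
Hypothesis fconvex : forall w w' y y', W w -> W w' ->
  alpha / 2 * l2norm (w - w') ^+ 2 <= f w y y' - f w' y y' - dotp (gradf w' y y') (w - w').
Hypothesis n_gt0 : (0 < n)%N.
Hypothesis eta_gt0 : forall j, (1 <= j)%N -> 0 < eta j.
Hypothesis Ww0 : W w0.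
Implicit Types (idx : nat -> 'I_n) (u v : 'rV[R]_d) (j t : nat).

Let w := sgd gradf z W eta w0.
Let F := draw_risk f z.

Let nR_neq0 : (n%:R : R) != 0. Proof. by rewrite pnatr_eq0 -lt0n. Qed.

Lemma sgd_in idx j : W (w idx j).
Proof. by case: j => [//|j]; exact: proj_in. Qed.

Lemma sgd_depends j : depends_below j.+1 (fun idx => w idx j).
Proof.
elim: j => [//|j IH] b b' bb'.
by rewrite /w /= -/(w b j) -/(w b' j) (IH b b') ?bb' // => k kj; apply: bb'; rewrite ltnW.
Qed.

Lemma sgd_average_depends (a : nat -> R) t :
  depends_below t.+1 (fun idx => sgd_average gradf z a W eta w0 idx t).
Proof.
move=> b b' bb'; congr (_ *: _); apply: eq_big_nat => j /andP[_ jt]; congr (_ *: _).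
by apply: sgd_depends => k kj; apply: bb'; lia.
Qed.

Definition drawn_loss idx j v := f v (z (idx j)) (z (idx j.-1)).

(** The descent inequality speaks of the loss at iterate [j.-1]. Passing to the delayed iterate
    [j - 2] costs the drift of one earlier step, whence the term [eta j.-1 * eta j]. For [j = 1]
    both iterates are [w0], so the boolean factor removes this term. *)
Lemma sgd_step idx j u : (1 <= j)%N -> W u ->
  eta j * (drawn_loss idx j (w idx (j - 2)%N) - drawn_loss idx j u) <=
  2^-1 * ((1 - alpha * eta j) * l2norm (w idx j.-1 - u) ^+ 2 - l2norm (w idx j - u) ^+ 2)
  + G ^+ 2 * (eta j.-1 *+ (1 < j)%N * eta j + eta j ^+ 2 / 2).
Proof.
have gradG i v : W v -> forall u, W u ->
    - dotp (gradf v (z (idx i.+1)) (z (idx i))) (u - v) <= G * l2norm (u - v).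
  move=> Wv u' Wu'; apply: (loss_gradient_lipschitz Wconvex _ (fgrad _ _ Wv)) => //.
  by move=> x y Wx Wy; exact: flip.
case: j => [//|j] _ Wu /=.
have Wj := sgd_in idx j; have ej := eta_gt0 (ltn0Sn j).
have := proj_step_descent Wconvex Wn0 Wclosed (ltW ej) (gradG j _ Wj) Wu.
rewrite -/(w idx j.+1) -/w.
have := fconvex (z (idx j.+1)) (z (idx j)) Wu Wj.
have drift : drawn_loss idx j.+1 (w idx (j.+1 - 2)%N) - drawn_loss idx j.+1 (w idx j) <=
    G ^+ 2 * (eta j *+ (1 < j.+1)%N).
  case: j Wj ej => [|j] Wj ej; first by rewrite mulr0n mulr0 subrr.
  have Wj1 := sgd_in idx j; rewrite subn2 /= mulr1n.
  have := proj_step_small Wconvex Wn0 Wclosed (ltW (eta_gt0 (ltn0Sn j))) Wj1 (gradG j _ Wj1).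
  rewrite -/(w idx j.+1) [eta _ * _]mulrC => /(le_trans _); apply.
  by rewrite l2norm_distC; apply: le_trans (ler_norm _) (flip _ _ _ _).
rewrite -/(drawn_loss idx j.+1 u) -/(drawn_loss idx j.+1 (w idx j)) l2norm_distC /=.
set p := dotp _ _; set D := l2norm (_ - u) ^+ 2; set D' := l2norm (_ - u) ^+ 2.
move: drift; set A := drawn_loss _ _ _; set B := drawn_loss _ _ _; set C := drawn_loss _ _ _.
set e := eta j *+ _ => drift conv step.
have h1 := ler_wpM2l (ltW ej) drift; have h2 := ler_wpM2l (ltW ej) conv.
by move: h1 h2 step; rewrite /=; nra.
Qed.

(** The mean of the gradients over all ordered pairs serves as [g]. *)
Lemma draw_risk_subgradient v : W v -> exists g, forall u, W u ->
  alpha / 2 * l2norm (u - v) ^+ 2 <= F u - F v - dotp g (u - v).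
Proof.
move=> Wv; exists ((n%:R ^+ 2)^-1 *: \sum_(i < n) \sum_(j < n) gradf v (z i) (z j)).
move=> u Wu; rewrite dotpZl /F /draw_risk -!mulrBr.
have dotp_suml (h : 'I_n -> 'rV[R]_d) x : dotp (\sum_i h i) x = \sum_i dotp (h i) x.
  by apply: (big_morph (fun h => dotp h x)) => [? ?|]; rewrite ?dotpDl ?dotp0l.
have n2 : 0 < n%:R ^+ 2 :> R by rewrite exprn_gt0 // ltr0n.
have sum_cst (x : R) : n%:R ^+ 2 * x = \sum_(i < n) \sum_(j < n) x.
  by rewrite !sumr_const card_ord -mulrnA -[RHS]mulr_natl natrM expr2.
rewrite ler_pdivlMl // sum_cst dotp_suml -!sumrB.
apply: ler_sum => i _; rewrite dotp_suml -!sumrB; apply: ler_sum => j _.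
exact: fconvex.
Qed.

(** Jensen's inequality from the subgradient at the average [m]: the weighted linear terms sum to
    zero there. *)
Lemma draw_risk_average (a : nat -> R) idx t u : (1 <= t)%N ->
  (forall j, (1 <= j)%N -> 0 < a j) ->
  F (sgd_average gradf z a W eta w0 idx t) - F u <=
  (\sum_(1 <= j < t.+1) a j)^-1 * \sum_(1 <= j < t.+1) a j * (F (w idx (j - 2)%N) - F u).
Proof.
move=> t_gt0 a_gt0; set m := sgd_average _ _ _ _ _ _ _ _; set A := \sum_(1 <= j < _) a j.
have A_gt0 : 0 < A by exact: psumr_nat_gt0.
have Wm : W m by apply: convex_set_barycenter => // j; exact: sgd_in.
have [g gP] := draw_risk_subgradient Wm.
rewrite ler_pdivlMl // {1}/A mulr_suml.
have zero : \sum_(1 <= j < t.+1) a j * dotp g (w idx (j - 2)%N - m) = 0.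
  under eq_bigr do rewrite -dotpZr dotpC.
  rewrite -(big_morph (fun h => dotp h g) (fun h h' => dotpDl h h' g) (dotp0l g)).
  under eq_bigr do rewrite scalerBr.
  rewrite sumrB -scaler_suml -/A /m /sgd_average scalerA mulfV ?gt_eqF // scale1r.
  by rewrite subrr dotp0l.
rewrite -[leLHS]addr0 -[X in _ + X <= _]zero -big_split /=.
rewrite [X in X <= _]big_nat [X in _ <= X]big_nat; apply: ler_sum => j /andP[j1 _].
have := gP _ (sgd_in idx (j - 2)%N); have := sqr_ge0 (l2norm (w idx (j - 2)%N - m)).
have := a_gt0 j j1; set D := l2norm _ ^+ 2 => aj D0 conv.
have : 0 <= alpha / 2 * D by rewrite mulr_ge0 // divr_ge0.
by move=> /le_trans/(_ conv)/(ler_wpM2l (ltW aj)); nra.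
Qed.

(** Under uniform draws it has mean zero given the indices below [j.-1], which already determine the
    delayed iterate. *)
Definition noise idx u j :=
  F (w idx (j - 2)%N) - F u - (drawn_loss idx j (w idx (j - 2)%N) - drawn_loss idx j u).

(** Hoeffding's lemma on ordered pairs, diagonal included. The components are swapped because the
    later draw is the first data argument of [f]. *)
Lemma draw_mgf u v (c s : R) : 0 <= s ->
  (forall y y', `|f v y y' - f u y y'| <= c) ->
  \sum_(i < n) \sum_(i' < n)
    expR (s * (F v - F u - (f v (z i') (z i) - f u (z i') (z i)))) <=
  n%:R ^+ 2 * expR ((s * c) ^+ 2 / 2).
Proof.
move=> s0 fc; pose x (p : 'I_n * 'I_n) := f v (z p.2) (z p.1) - f u (z p.2) (z p.1).
have meanE : (n%:R ^+ 2)^-1 * \sum_p x p = F v - F u.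
  rewrite /F /draw_risk -mulrBr; congr (_ * _); rewrite /x.
  rewrite -(pair_bigA _ (fun i j : 'I_n => f v (z j) (z i) - f u (z j) (z i))).
  by rewrite exchange_big -sumrB; apply: eq_bigr => k _; rewrite -sumrB.
have cardE : (#|{: 'I_n * 'I_n}|%:R : R) = n%:R ^+ 2.
  by rewrite card_prod card_ord natrM expr2.
have := @hoeffding_finite R _ x c s _ s0 (fun p => fc _ _).
rewrite cardE meanE pair_bigA; apply.
by rewrite card_prod card_ord muln_gt0 n_gt0.
Qed.

Lemma sum_drawn_convex idx t u : W u -> alpha = 0 ->
  0 <= eta 0%N ->
  \sum_(1 <= j < t.+1) eta j * (drawn_loss idx j (w idx (j - 2)%N) - drawn_loss idx j u) <=
  1 / 2 * l2norm (w0 - u) ^+ 2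
  + G ^+ 2 * \sum_(1 <= j < t.+1) (eta (j - 1)%N * eta j + eta j ^+ 2 / 2).
Proof.
move=> Wu alpha0 eta0_ge0.
have tele k : \sum_(1 <= j < k.+1)
      eta j * (drawn_loss idx j (w idx (j - 2)%N) - drawn_loss idx j u) <=
    1 / 2 * (l2norm (w0 - u) ^+ 2 - l2norm (w idx k - u) ^+ 2)
    + G ^+ 2 * \sum_(1 <= j < k.+1) (eta (j - 1)%N * eta j + eta j ^+ 2 / 2).
  elim: k => [|k IH]; first by rewrite !big_nil subrr !mulr0 addr0.
  rewrite !(@big_nat_recr _ _ _ k.+1) //=.
  have := sgd_step idx (ltn0Sn k) Wu; rewrite alpha0 mul0r subr0 mul1r subn1 /=.
  (* For [k = 0] there is no drift, while the target sum contains [eta 0], which is nonnegative. *)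
  have ek : eta k *+ (1 < k.+1)%N <= eta k.
    by case: k {IH} => [|k]; rewrite ?mulr0n ?mulr1n.
  have := ler_wpM2l (sqr_ge0 G) (ler_wpM2r (ltW (eta_gt0 (ltn0Sn k))) ek).
  move: IH; lra.
apply: le_trans (tele t) _; rewrite lerD2r ler_wpM2l // gerBl; exact: sqr_ge0.
Qed.

(** Multiplying step [j] by [j / eta j = alpha * j * (j + 1) / 2] makes the squared distances
    telescope with weights [alpha / 4 * j * (j + 1)]. Each step adds at most [3 * G ^+ 2 / alpha]: 2
    parts from the drift, 1 from the squared step size. *)
Lemma sum_drawn_strongly_convex idx t u : W u -> 0 < alpha ->
  (forall j, (1 <= j)%N -> eta j = 2 / (alpha * (j%:R + 1))) ->
  \sum_(1 <= j < t.+1) j%:R * (drawn_loss idx j (w idx (j - 2)%N) - drawn_loss idx j u) <=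
  3 * G ^+ 2 * t%:R / alpha.
Proof.
move=> Wu alpha_gt0 etaE.
have a0 : alpha != 0 by rewrite gt_eqF.
have drift k : (k%:R + 1) * (eta k *+ (1 < k.+1)%N) <= 2 / alpha.
  case: k => [|k]; first by rewrite mulr0n mulr0 divr_ge0.
  rewrite mulr1n etaE // le_eqVlt; apply/orP; left; apply/eqP.
  by field; rewrite a0 /= gt_eqF // ltr_wpDl // ler0n.
have tele k : \sum_(1 <= j < k.+1)
      j%:R * (drawn_loss idx j (w idx (j - 2)%N) - drawn_loss idx j u) <=
    3 * G ^+ 2 * k%:R / alpha - alpha / 4 * (k%:R * (k%:R + 1)) * l2norm (w idx k - u) ^+ 2.
  elim: k => [|k IH]; first by rewrite big_nil !(mul0r, mulr0) subrr.
  rewrite big_nat_recr //=; apply: le_trans (lerD IH (lexx _)) _.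
  have := sgd_step idx (ltn0Sn k) Wu; rewrite etaE //=.
  set X := drawn_loss _ _ _ - _; set D := l2norm _ ^+ 2; set D' := l2norm _ ^+ 2.
  set e := eta k *+ _; rewrite -[k.+1%:R]natr1; set K : R := k%:R => h.
  have K0 : 0 <= K by exact: ler0n.
  have ek : (K + 1) * e <= 2 / alpha by exact: drift.
  have M0 : 0 <= alpha * (K + 1) * (K + 2) / 2.
    by rewrite divr_ge0 // !mulr_ge0 // addr_ge0.
  have K2 : K + 1 + 1 != 0 by rewrite gt_eqF //; lra.
  have := ler_wpM2l M0 h.
  rewrite (_ : _ * (_ * X) = (K + 1) * X); last by field; rewrite a0 K2.
  rewrite (_ : alpha * _ * _ / 2 * _ = alpha / 4 * (K * (K + 1)) * D
     - alpha / 4 * ((K + 1) * (K + 1 + 1)) * D'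
     + G ^+ 2 * ((K + 1) * e + (K + 1) / (K + 1 + 1) / alpha)); last first.
    by field; rewrite ?a0 ?K2.
  move=> hh; apply: le_trans (lerD (lexx _) hh) _.
  have frac : (K + 1) / (K + 1 + 1) / alpha <= 1 / alpha.
    by rewrite ler_pM2r ?invr_gt0 // ler_pdivrMr; lra.
  have := ler_wpM2l (sqr_ge0 G) (lerD ek frac).
  rewrite (_ : 3 * G ^+ 2 * (K + 1) / alpha =
    3 * G ^+ 2 * K / alpha + G ^+ 2 * (2 / alpha + 1 / alpha)); last by field.
  lra.
apply: le_trans (tele t) _; rewrite gerBl mulr_ge0 ?sqr_ge0 //.
by rewrite mulr_ge0 ?divr_ge0 // mulr_ge0 // addr_ge0.
Qed.

(* Working with an approximate minimiser avoids the existence of a minimiser. *)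
Lemma draw_risk_near_minimizer (e : R) : 0 < e ->
  (forall v y y', W v -> 0 <= f v y y') ->
  exists2 u, W u & forall v, W v ->
    F u <= F v + e /\ alpha / 4 * l2norm (v - u) ^+ 2 <= F v - F u + 2 * e.
Proof.
move=> e_gt0 f_ge0.
have F_ge0 v : W v -> 0 <= F v.
  move=> Wv; rewrite /F /draw_risk mulr_ge0 ?invr_ge0 ?exprn_ge0 ?ler0n //.
  by apply: sumr_ge0 => i _; apply: sumr_ge0 => j _; exact: f_ge0.
have Finf : has_inf [set F v | v in W].
  split; first by exists (F w0); exists w0.
  by exists 0 => _ [v Wv <-]; exact: F_ge0.
have [_ [u Wu <-] ulow] := inf_adherent e_gt0 Finf.
have umin v : W v -> F u <= F v + e.
  move=> Wv; apply: ltW; apply: lt_le_trans ulow _; rewrite lerD2r.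
  by apply: ge_inf; [case: Finf | exists v].
exists u => // v Wv; split; first exact: umin.
(* Add the strong convexity inequalities from the midpoint towards both ends: the linear terms
   cancel, and near minimality of [u] bounds [F m] below. *)
pose m := u + 2^-1 *: (v - u).
have Wm : W m by apply: convex_set_segment => //; apply/andP; split; lra.
have [g gP] := draw_risk_subgradient Wm.
have := gP _ Wv; have := gP _ Wu; have := umin _ Wm.
have -> : u - m = (- 2^-1) *: (v - u) by rewrite /m opprD addrA subrr add0r scaleNr.
have -> : v - m = 2^-1 *: (v - u).
  rewrite /m opprD addrA -{1}[v - u]scale1r -scalerBl; congr (_ *: _); lra.
rewrite !l2normZ !dotpZr !exprMn normrN gtr0_norm ?invr_gt0 //.
set D := l2norm _ ^+ 2; set p := dotp _ _; lra.
Qed.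

(** * High-probability bounds for the averaged iterate *)

Section high_probability.
Variables (dsp : measure_display) (Om : measurableType dsp) (P : probability Om R).
Variable I : nat -> Om -> 'I_n.
Hypothesis Iiid : iid_uniform P I.

(** The range [c] may depend on the iterate, so the variance term stays random: it is constant in
    the convex case and is absorbed by the risk in the strongly convex one. *)
Lemma sgd_noise_tail (a : nat -> R) (c : 'rV[R]_d -> R) (s : R) u t T (delta : R)
    (Q : (nat -> 'I_n) -> bool) :
  (forall j, 0 <= a j) -> 0 < s -> 0 < delta ->
  (forall v y y', W v -> `|f v y y' - f u y y'| <= c v) ->
  depends_below T Q ->
  (forall idx, \sum_(1 <= j < t.+1) a j * noise idx u j <=
     s * (\sum_(1 <= j < t.+1) a j ^+ 2 * c (w idx (j - 2)%N) ^+ 2) + ln (1 / delta) / s ->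
     Q idx) ->
  ((1 - delta)%:E <= P [set om | Q (I ^~ om)])%E.
Proof.
move=> a_ge0 s_gt0 delta_gt0 fc Qdep noiseQ.
(* The subtracted compensator is exact: doubling [y j] gives the Hoeffding exponent
   [(2 * s * a j * c) ^+ 2 / 2], twice the compensator. *)
pose y j idx := s * (a j * noise idx u j) - s ^+ 2 * (a j ^+ 2 * c (w idx (j - 2)%N) ^+ 2).
apply: (@iid_uniform_tail _ _ _ _ _ I n_gt0 Iiid Q T y t) => //.
- move=> j b b' bb'; rewrite /y /noise /drawn_loss.
  by rewrite (sgd_depends (b' := b')) ?bb' ?ltnS ?leq_pred // => k kj; apply: bb'; lia.
- move=> j b; set b' := fun i i' => upd (upd b j i) j.+1 i'.
  pose v := w b (j.+1 - 2)%N; have Wv : W v := sgd_in b _.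
  (* Redrawing indices [j] and [j.+1] leaves the delayed iterate unchanged; for [j = 0] it is
     [w0]. *)
  have vE i i' : w (b' i i') (j.+1 - 2)%N = v.
    case: j @v Wv @b' => [//|j] v _ b'; apply: sgd_depends => k kj.
    by rewrite /b' !upd_below //; lia.
  have yE i i' : expR (2 * y j.+1 (b' i i')) =
      expR (2 * s * a j.+1 * (F v - F u - (f v (z i') (z i) - f u (z i') (z i)))) *
      expR (- (2 * s ^+ 2 * (a j.+1 ^+ 2 * c v ^+ 2))).
    rewrite -expRD /y /noise /drawn_loss vE /= /b' upd_eq upd_below // upd_eq.
    congr expR; ring.
  under eq_bigr do under eq_bigr do rewrite yE.
  under eq_bigr do rewrite -mulr_suml.
  rewrite -mulr_suml -[leRHS]mulr1.
  rewrite -[X in _ <= _ * X](expRxMexpNx_1 (2 * s ^+ 2 * (a j.+1 ^+ 2 * c v ^+ 2))).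
  rewrite [leRHS]mulrA ler_pM2r ?expR_gt0 //.
  have -> : 2 * s ^+ 2 * (a j.+1 ^+ 2 * c v ^+ 2) = (2 * s * a j.+1 * c v) ^+ 2 / 2 by field.
  apply: draw_mgf; last by move=> *; exact: fc.
  by rewrite !mulr_ge0 // ltW.
- move=> b; rewrite /y sumrB -!mulr_sumr => h; apply: noiseQ.
  rewrite -(ler_pM2l s_gt0) mulrDr mulrA -expr2 -lerBlDl.
  by rewrite [s * (_ / s)]mulrC divfK // gt_eqF.
Qed.

Lemma risk_decomposition (a : nat -> R) idx u t :
  \sum_(1 <= j < t.+1) a j * (F (w idx (j - 2)%N) - F u) =
  \sum_(1 <= j < t.+1) a j * noise idx u j +
  \sum_(1 <= j < t.+1) a j * (drawn_loss idx j (w idx (j - 2)%N) - drawn_loss idx j u).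
Proof.
by rewrite -big_split; apply: eq_bigr => j _ /=; rewrite -mulrDr /noise subrK.
Qed.

Hypothesis f_ge0 : forall v y y', W v -> 0 <= f v y y'.
Variables (delta : R) (t : nat).
Hypotheses (delta01 : 0 < delta < 1) (t_gt0 : (1 <= t)%N).

Let delta_gt0 : 0 < delta. Proof. by case/andP: delta01. Qed.

Let l_gt0 : 0 < ln (1 / delta).
Proof. by case/andP: delta01 => d0 d1; rewrite ln_gt0 // ltr_pdivlMr // mul1r. Qed.

Lemma draw_risk_tail_convex (B : R) u : W u -> alpha = 0 -> 0 <= eta 0%N -> 0 < B ->
  (forall v y y', W v -> f v y y' <= B) ->
  ((1 - delta)%:E <= P [set om |
    (F (sgd_average gradf z eta W eta w0 (I ^~ om) t) - F u <=
     (\sum_(1 <= j < t.+1) eta j)^-1 *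
       (2 * B * Num.sqrt (2 * (\sum_(1 <= j < t.+1) eta j ^+ 2) * ln (2 / delta))
        + 1 / 2 * l2norm (w0 - u) ^+ 2
        + G ^+ 2 * \sum_(1 <= j < t.+1) (eta (j - 1)%N * eta j + eta j ^+ 2 / 2)))%R])%E.
Proof.
move=> Wu alpha0 eta0_ge0 B_gt0 fB.
set V := \sum_(1 <= j < t.+1) eta j ^+ 2; set bound := _ * (_ + _).
have V_gt0 : 0 < V by apply: psumr_nat_gt0 => // j j1; rewrite exprn_gt0 ?eta_gt0.
have A_gt0 : 0 < \sum_(1 <= j < t.+1) eta j by exact: psumr_nat_gt0.
pose q := Num.sqrt (ln (1 / delta)); pose r := Num.sqrt V.
have q_gt0 : 0 < q by rewrite sqrtr_gt0.
have r_gt0 : 0 < r by rewrite sqrtr_gt0.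
have qE : ln (1 / delta) = q ^+ 2 by rewrite sqr_sqrtr // ltW.
have rE : V = r ^+ 2 by rewrite sqr_sqrtr // ltW.
(* This [s] minimises [s * r ^+ 2 * B ^+ 2 + q ^+ 2 / s], with minimum [2 * B * q * r]. The range is
   [B] because losses lie between 0 and [B]. *)
apply: (@sgd_noise_tail eta (fun=> B) (q / (r * B)) u t t.+1 delta
  (fun idx => F (sgd_average gradf z eta W eta w0 idx t) - F u <= bound)) => //.
- by case=> [//|j]; rewrite ltW ?eta_gt0.
- by rewrite divr_gt0 // mulr_gt0.
- move=> v y y' Wv; have := f_ge0 y y' Wv; have := fB v y y' Wv.
  have := f_ge0 y y' Wu; have := fB u y y' Wu.
  by rewrite ler_norml => *; apply/andP; split; lra.
- by move=> b b' bb'; rewrite (sgd_average_depends eta bb').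
move=> idx noise_le; apply: le_trans (draw_risk_average _ _ t_gt0 eta_gt0) _.
rewrite ler_pM2l ?invr_gt0 // risk_decomposition -addrA; apply: lerD; last first.
  exact: sum_drawn_convex.
apply: le_trans noise_le _; rewrite -mulr_suml -/V qE {1}rE.
have -> : q / (r * B) * (r ^+ 2 * B ^+ 2) + q ^+ 2 / (q / (r * B)) = 2 * B * (q * r).
  by field; rewrite !gt_eqF.
rewrite ler_pM2l ?mulr_gt0 // /q /r -sqrtrM ?(ltW l_gt0) //; apply: ler_wsqrtr.
have l2 : ln (1 / delta) <= ln (2 / delta).
  by rewrite ler_ln ?posrE ?divr_gt0 // ler_pM2r ?invr_gt0 // ler1n.
have : ln (1 / delta) * V <= ln (2 / delta) * V by rewrite ler_pM2r.
by have : 0 < ln (1 / delta) * V by [rewrite mulr_gt0]; lra.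
Qed.

Lemma draw_risk_tail_strongly_convex (delta0 : R) u : W u -> 0 < alpha ->
  (forall j, (1 <= j)%N -> eta j = 2 / (alpha * (j%:R + 1))) ->
  0 < delta0 < 1 -> delta <= delta0 ->
  ((1 - delta)%:E <= P [set om |
    (F (sgd_average gradf z (fun j => j%:R) W eta w0 (I ^~ om) t) - F u <=
     (32 + 15 / ln (1 / delta0)) *
       (G ^+ 2 * ln (1 / delta) / (alpha * t%:R)))%R])%E.
Proof.
move=> Wu alpha_gt0 etaE /andP[d0_gt0 d0_lt1] dd0; set bound := _ * (_ / _).
set l := ln (1 / delta) in bound *; set l0 := ln (1 / delta0) in bound *.
have l0_gt0 : 0 < l0 by rewrite ln_gt0 // ltr_pdivlMr // mul1r.
have l0l : l0 <= l.
  by rewrite ler_ln ?posrE ?divr_gt0 // ler_pM2l // lef_pV2 ?posrE.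
have tR : 0 < t%:R :> R by rewrite ltr0n.
have weight_gt0 j : (1 <= j)%N -> 0 < j%:R :> R by rewrite ltr0n.
have dep : depends_below t.+1 (fun idx =>
    F (sgd_average gradf z (fun j => j%:R) W eta w0 idx t) - F u <= bound).
  by move=> b b' bb'; rewrite (sgd_average_depends (fun j => j%:R) bb').
have bound_ge0 : 0 <= bound.
  rewrite mulr_ge0 ?addr_ge0 // divr_ge0 // ?(ltW l0_gt0) //.
    by rewrite mulr_ge0 ?sqr_ge0 // (le_trans (ltW l0_gt0)).
  by rewrite mulr_ge0 // ltW.
(* If [G <= 0], strong convexity reduces [W] to the point [u], and the excess risk is 0. *)
have [G_le0|G_gt0] := leP G 0.
  have Wsing v : W v -> v = u.
    move=> Wv; apply/eqP; rewrite -subr_eq0; apply/eqP/l2norm_eq0.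
    have y0 := z (Ordinal n_gt0); have Nge0 := l2norm_ge0 (v - u).
    have GN : G * l2norm (v - u) <= 0 by rewrite mulr_le0_ge0.
    have := le_trans (flip y0 y0 Wv Wu) GN; rewrite normr_le0 subr_eq0 => /eqP fvu.
    have := fconvex y0 y0 Wv Wu; rewrite fvu subrr sub0r.
    have := loss_gradient_lipschitz Wconvex (fun x y => flip y0 y0 (w := x) (w' := y))
      (fgrad y0 y0 Wu) Wu Wv.
    move=> h1 h2; have := le_trans h2 (le_trans h1 GN).
    rewrite pmulr_rle0 ?divr_gt0 // => h3; apply/eqP.
    by rewrite -sqrf_eq0 eq_le h3 sqr_ge0.
  rewrite [X in P X](_ : _ = setT); last first.
    apply/seteqP; split => om // _ /=.
    rewrite (Wsing (sgd_average _ _ _ _ _ _ _ _)) ?subrr //.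
    by apply: convex_set_barycenter => // j; exact: sgd_in.
  by rewrite probability_setT lee_fin gerBl ltW.
(* The accuracy of the near-minimiser is of the order of the bound to be proved. *)
have e_gt0 : 0 < G ^+ 2 / (alpha * t%:R) by rewrite divr_gt0 ?mulr_gt0 ?exprn_gt0.
set e := G ^+ 2 / _ in e_gt0.
have [u0 Wu0 u0P] := draw_risk_near_minimizer e_gt0 f_ge0.
have s_gt0 : 0 < alpha / (8 * t%:R * G ^+ 2).
  by rewrite divr_gt0 // !mulr_gt0 // exprn_gt0.
set s := alpha / _ in s_gt0.
apply: (@sgd_noise_tail (fun j => j%:R) (fun v => G * l2norm (v - u0)) s u0 t t.+1 delta
  (fun idx => F (sgd_average gradf z (fun j => j%:R) W eta w0 idx t) - F u <= bound)) => //.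
  by move=> v y y' Wv; exact: flip.
move=> idx noise_le.
have [Fu0 _] := u0P _ Wu.
have := draw_risk_average idx u0 t_gt0 weight_gt0.
set S := \sum_(1 <= j < t.+1) _ * (_ - _).
have NE : \sum_(1 <= j < t.+1) (j%:R : R) = t%:R * (t%:R + 1) / 2.
  elim: t => [|k IH]; first by rewrite big_nil !mul0r.
  by rewrite big_nat_recr //= IH -[k.+1%:R]natr1; field.
set N := t%:R * _ / 2 in NE *; rewrite NE => avg_le.
have N_gt0 : 0 < N by rewrite divr_gt0 // mulr_gt0 // ltr_wpDl // ltW.
(* The choice of s makes the variance term at most half of the weighted risk. *)
have var_le : s * (\sum_(1 <= j < t.+1)
    j%:R ^+ 2 * (G * l2norm (w idx (j - 2)%N - u0)) ^+ 2) <= 2^-1 * S + N * e.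
  rewrite -NE /S mulr_sumr mulr_suml mulr_sumr -big_split /=.
  rewrite [leLHS]big_nat [leRHS]big_nat; apply: ler_sum => j /andP[j1 jt].
  have [_ growth] := u0P _ (sgd_in idx (j - 2)%N).
  move: growth; set D := l2norm _; set X := F _ - F u0 => growth.
  have jR := weight_gt0 _ j1; have jtR : j%:R <= t%:R :> R by rewrite ler_nat.
  have -> : s * (j%:R ^+ 2 * (G * D) ^+ 2) =
      2^-1 * j%:R * (alpha / 4 * D ^+ 2) * (j%:R / t%:R).
    by rewrite /s; field; rewrite !gt_eqF.
  have D0 : 0 <= 2^-1 * j%:R * (alpha / 4 * D ^+ 2).
    by rewrite !mulr_ge0 ?invr_ge0 ?l2norm_ge0.
  have jt1 : j%:R / t%:R <= 1 :> R by rewrite ler_pdivrMr // mul1r.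
  apply: le_trans (ler_wpM2l D0 jt1) _.
  have := ler_wpM2l (ltW jR) growth; lra.
have := sum_drawn_strongly_convex idx t Wu0 alpha_gt0 etaE.
have := risk_decomposition (fun j => j%:R) idx u0 t; rewrite /= -/S => SE drawn_le.
(* The half of [S] inside the variance term moves to the left, which doubles the remaining terms. *)
have S_le : S <= 2 * N * e + 16 * t%:R * G ^+ 2 / alpha * l + 6 * G ^+ 2 * t%:R / alpha.
  have -> : 16 * t%:R * G ^+ 2 / alpha * l = 2 * (l / s).
    by rewrite /s; field; rewrite !gt_eqF.
  by move: noise_le drawn_le var_le; rewrite SE -/l; lra.
have NV : 0 <= N^-1 by rewrite invr_ge0 ltW.
have {}avg_le := le_trans avg_le (ler_wpM2l NV S_le).
(* Passing from [u0] to the arbitrary [u] costs one more [e]. *)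
have : F (sgd_average gradf z (fun j => j%:R) W eta w0 idx t) - F u <=
    N^-1 * (2 * N * e + 16 * t%:R * G ^+ 2 / alpha * l + 6 * G ^+ 2 * t%:R / alpha) + e.
  by lra.
move=> /le_trans; apply.
have t1 : 0 < t%:R + 1 :> R by rewrite ltr_wpDl // ltW.
pose g := G ^+ 2 / alpha; have g_gt0 : 0 < g by rewrite divr_gt0 // exprn_gt0.
have -> : N^-1 * (2 * N * e + 16 * t%:R * G ^+ 2 / alpha * l + 6 * G ^+ 2 * t%:R / alpha) + e =
    3 * g / t%:R + (32 * l + 12) * g / (t%:R + 1).
  by rewrite /N /e /g; field; rewrite !gt_eqF.
have -> : bound = (32 * l + 15 * (l / l0)) * g / t%:R.
  by rewrite /bound /g; field; rewrite !gt_eqF.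
(* Here [delta <= delta0] enters: the parts free of [l], 3 and 12, are absorbed into
   [15 * (l / l0)]. *)
have ll0 : 1 <= l / l0 by rewrite ler_pdivlMr // mul1r.
have h1 : (32 * l + 12) * g / (t%:R + 1) <= (32 * l + 12) * g / t%:R.
  apply: ler_wpM2l; last by rewrite lef_pV2 ?posrE // lerDl.
  by rewrite mulr_ge0 ?(ltW g_gt0) //; lra.
have h2 : 3 * g / t%:R + (32 * l + 12) * g / t%:R <= (32 * l + 15 * (l / l0)) * g / t%:R.
  by rewrite -mulrDl ler_pM2r ?invr_gt0 // -mulrDl ler_pM2r //; lra.
lra.
Qed.

End high_probability.

End sgd_analysis.

(** * Both bounds in terms of the empirical risk *)

Theorem theorem7 (R : realType) (delta0 : R) (hdelta0 : 0 < delta0 < 1) :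
  exists2 C : R, 0 < C &
  forall (d : nat) (W : set 'rV[R]_d) (Z : Type)
    (f : 'rV[R]_d -> Z -> Z -> R) (gradf : 'rV[R]_d -> Z -> Z -> 'rV[R]_d)
    (alpha G B : R) (n : nat) (z : 'I_n -> Z)
    (eta : nat -> R) (w0 : 'rV[R]_d)
    (dsp : measure_display) (Om : measurableType dsp) (P : probability Om R)
    (I : nat -> Om -> 'I_n) (t : nat) (delta : R),
  W !=set0 -> closed W -> @convex_set R 'rV[R]_d W ->
  (forall w y y', W w -> 0 <= f w y y') ->
  (forall w y y', W w -> loss_gradient W G (fun u => f u y y') w (gradf w y y')) ->
  0 <= alpha ->
  (forall w w' y y', W w -> W w' ->
    `|f w y y' - f w' y y'| <= G * l2norm (w - w')) ->
  (forall w w' y y', W w -> W w' ->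
    alpha / 2 * l2norm (w - w') ^+ 2 <=
      f w y y' - f w' y y' - dotp (gradf w' y y') (w - w')) ->
  0 < B ->
  (forall w y y', W w -> f w y y' <= B) ->
  (2 <= n)%N ->
  0 <= eta 0%N -> (forall j, (1 <= j)%N -> 0 < eta j) ->
  W w0 ->
  iid_uniform P I ->
  (1 <= t)%N ->
  0 < delta < 1 ->
  (alpha = 0 ->
    forall w, W w ->
    ((1 - delta)%:E <= P [set om |
      (let wbar := sgd_average gradf z eta W eta w0 (I ^~ om) t in
      emp_risk f z wbar - emp_risk f z w <=
        (\sum_(1 <= j < t.+1) eta j)^-1 *
          (2 * B * Num.sqrt (2 * (\sum_(1 <= j < t.+1) eta j ^+ 2) * ln (2 / delta))
           + 1 / 2 * l2norm (w0 - w) ^+ 2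
           + G ^+ 2 * \sum_(1 <= j < t.+1)
                        (eta (j - 1)%N * eta j + eta j ^+ 2 / 2))
        + (sampling_bias f z wbar - sampling_bias f z w))%R])%E) /\
  (0 < alpha ->
    (forall j, (1 <= j)%N -> eta j = 2 / (alpha * (j%:R + 1))) ->
    delta <= delta0 ->
    forall w, W w ->
    ((1 - delta)%:E <= P [set om |
      (let wbar := sgd_average gradf z (fun j => j%:R) W eta w0 (I ^~ om) t in
      emp_risk f z wbar - emp_risk f z w <=
        C * (G ^+ 2 * ln (1 / delta) / (alpha * t%:R))
        + (sampling_bias f z wbar - sampling_bias f z w))%R])%E).
Proof.
have [d0_gt0 d0_lt1] := andP hdelta0.
exists (32 + 15 / ln (1 / delta0)).
  by rewrite addr_gt0 // divr_gt0 // ln_gt0 // ltr_pdivlMr // mul1r.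
move=> d W Z f gradf alpha G B n z eta w0 dsp Om P I t delta Wn0 Wclosed Wconvex f_ge0
  fgrad alpha_ge0 flip fconvex B_gt0 fB n_ge2 eta0_ge0 eta_gt0 Ww0 Iiid t_gt0 delta01.
have n_gt0 : (0 < n)%N by exact: ltnW.
(* Subtracting the increment of [sampling_bias] turns the excess of [emp_risk] into that of
   [draw_risk], so the two events coincide. *)
have eventE (wbar : (nat -> 'I_n) -> 'rV[R]_d) w X :
    [set om | (emp_risk f z (wbar (I ^~ om)) - emp_risk f z w <=
      X + (sampling_bias f z (wbar (I ^~ om)) - sampling_bias f z w))%R] =
    [set om | (draw_risk f z (wbar (I ^~ om)) - draw_risk f z w <= X)%R].
  by apply/seteqP; split=> om /=; rewrite /sampling_bias => ?; lra.
split=> [alpha0 w Ww|alpha_gt0 etaE dd0 w Ww].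
- rewrite (eventE (fun idx => sgd_average gradf z eta W eta w0 idx t)).
  exact: (draw_risk_tail_convex z Wn0 Wclosed Wconvex fgrad alpha_ge0 flip fconvex n_gt0
    eta_gt0 Ww0 Iiid f_ge0).
- rewrite (eventE (fun idx => sgd_average gradf z (fun j => j%:R) W eta w0 idx t)).
  exact: (draw_risk_tail_strongly_convex z Wn0 Wclosed Wconvex fgrad alpha_ge0 flip fconvex
    n_gt0 eta_gt0 Ww0 Iiid f_ge0).
Qed.
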